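(* Let $\mathcal{X}$ be a linear space over $\mathbb{K}$ ($\mathbb{K}=\mathbb{R}$ or $\mathbb{C}$) and let $T$ be a linear relation in $\mathcal{X}$. The following are equivalent: (i) $T=PQ$ for some multivalued projections $P,Q$ in $\mathcal{X}$; (ii) $\operatorname{dom}T=\{x: T(x)=P_{\operatorname{ran}T,\mathcal{S}}(x)\}+\ker T$ for some subspace $\mathcal{S}$ of $\mathcal{X}$ such that $\mathcal{S}\cap\operatorname{ran}T=\operatorname{mul}T$. Here $\{x: T(x)=P_{\operatorname{ran}T,\mathcal{S}}(x)\}$ denotes the set of $x\in\operatorname{dom}T\cap\operatorname{dom}P_{\operatorname{ran}T,\mathcal{S}}$ with $T(x)=P_{\operatorname{ran}T,\mathcal{S}}(x)$.
   Context: A linear relation in $\mathcal{X}$ is a linear subspace $T$ of $\mathcal{X}\times\mathcal{X}$. Write $\operatorname{dom}T=\{x:\exists y,\ (x,y)\in T\}$, $\operatorname{ran}T=\{y:\exists x,\ (x,y)\in T\}$, $\ker T=\{x:(x,0)\in T\}$, $\operatorname{mul}T=\{y:(0,y)\in T\}$, and, for $x\in\operatorname{dom}T$, $T(x)=\{y:(x,y)\in T\}$. The product is $ST=\{(x,z): (x,y)\in T \text{ and } (y,z)\in S\text{ for some }y\}$. A multivalued projection in $\mathcal{X}$ is a linear relation $P$ in $\mathcal{X}$ with $P^2=P$ and $\operatorname{ran}P\subseteq\operatorname{dom}P$. For subspaces $\mathcal{M},\mathcal{N}$ of $\mathcal{X}$, $P_{\mathcal{M},\mathcal{N}}:=\{(m+n,m):m\in\mathcal{M},n\in\mathcal{N}\}$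 is the unique multivalued projection with range $\mathcal{M}$ and kernel $\mathcal{N}$; its domain is $\mathcal{M}+\mathcal{N}$ and its multivalued part is $\mathcal{M}\cap\mathcal{N}$. *)

(* Defs.v *)
From HB Require Import structures.
From mathcomp Require Import all_boot all_order all_algebra.
From mathcomp Require Import complex.
From mathcomp Require Import boolp classical_sets reals.

Set Implicit Arguments.
Unset Strict Implicit.
Unset Printing Implicit Defensive.

Import Order.TTheory GRing.Theory Num.Theory.
Local Open Scope classical_set_scope.
Local Open Scope ring_scope.

Inductive scalar_kind := RealScalars | ComplexScalars.

Definition scalars (R : realType) (k : scalar_kind) : numFieldType :=
  match k with
  | RealScalars => R
  | ComplexScalars => R[i]
  end.

Section LinearRelations.
Context {K : fieldType} {X : lmodType K}.
Implicit Types (T S P : set (X * X)) (M N : set X).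

Definition subspace (V : lmodType K) (A : set V) : Prop :=
  GRing.submod_closed (mem A).

Definition linear_relation T : Prop := subspace T.

Definition rel_dom T : set X := T.`1.
Definition rel_ran T : set X := T.`2.
Definition rel_ker T : set X := [set x | T (x, 0)].
Definition rel_mul T : set X := [set y | T (0, y)].

(* T(x), which is empty when x is outside the domain. *)
Definition image_at T (x : X) : set X := xsection T x.

(* [B \; A] relates x to z through A first and B second, as in the product ST. *)
Definition rel_prod S T : set (X * X) := (S \; T)%relation.

Definition set_sum M N : set X := [set m + n | m in M & n in N].

Definition multivalued_projection P : Prop :=
  [/\ linear_relation P, rel_prod P P = P & rel_ran P `<=` rel_dom P].

Definition mvproj M N : set (X * X) := [set (m + n, m) | m in M & n in N].

Definition agreement T P : set X :=
  [set x | (rel_dom T `&` rel_dom P) x /\ image_at T x = image_at P x].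

End LinearRelations.

(* Main.v *)
Require Import Defs.
From mathcomp Require Import all_boot all_order all_algebra.
From mathcomp Require Import boolp classical_sets reals.

(** Why the theorem is true.  A fibre of a linear relation is a coset of its
    multivalued part, so two linear relations with the same multivalued part
    agree exactly where their graphs meet ([agreement_dom_setI]).  The condition
    [S `&` rel_ran T = rel_mul T] says that [T] and [mvproj (rel_ran T) S] have
    the same multivalued part ([rel_mul_mvproj]); hence their agreement set is
    the domain of the intersection of the two relations, in particular a
    subspace.

    If [T = P Q], take [S := ker P + mul Q].  Multivalued projections fix their
    range, so for [(x, y)] in [Q] and [(y, z)] in [P] the vector [y] lies in the
    agreement set, since [y = z + (y - z)] with [y - z] in [ker P], while
    [x - y] lies in [ker Q], which is contained in [ker T].

    Conversely, given [S], let [A] be the agreement set.  Then [T] is the product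
    of [mvproj (rel_ran T) S] and [mvproj A (rel_ker T)]: the second factor
    discards a component in [ker T], and on what remains the first factor is [T]
    itself. *)

Local Open Scope classical_set_scope.
Local Open Scope ring_scope.

Import GRing.Theory.

Section LinearRelationTheory.
Set Implicit Arguments.
Unset Strict Implicit.
Unset Printing Implicit Defensive.
Context {K : fieldType} {X : lmodType K}.
Implicit Types (T P Q : set (X * X)) (M N S : set X).

(** * Subspaces and linear relations *)

Lemma subspaceP (V : lmodType K) (A : set V) :
  subspace A <->
  A 0 /\ forall (a : K) (u v : V), A u -> A v -> A (a *: u + v).
Proof.
split=> -[A0 Alin]; split; first by move: A0; rewrite inE.
- by move=> a u v Au Av; have := Alin a u v; rewrite !inE; apply.
- by rewrite inE.
- by move=> a u v; rewrite !inE; exact: Alin.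
Qed.

Section SubspaceClosure.
Context {V : lmodType K} {A : set V} (hA : subspace A).

Lemma subspace0 : A 0.
Proof. by have /subspaceP[] := hA. Qed.

Lemma subspaceZD (a : K) (u v : V) : A u -> A v -> A (a *: u + v).
Proof. by have /subspaceP[_] := hA; apply. Qed.

Lemma subspaceD (u v : V) : A u -> A v -> A (u + v).
Proof. by move=> Au Av; rewrite -[u]scale1r; exact: subspaceZD. Qed.

Lemma subspaceB (u v : V) : A u -> A v -> A (u - v).
Proof. by move=> Au Av; rewrite addrC -scaleN1r; exact: subspaceZD. Qed.

Lemma subspaceN (u : V) : A u -> A (- u).
Proof. by rewrite -[- u]add0r; apply: subspaceB; exact: subspace0. Qed.

End SubspaceClosure.

Lemma subspaceI (V : lmodType K) (A B : set V) :
  subspace A -> subspace B -> subspace (A `&` B).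
Proof.
move=> hA hB; apply/subspaceP; split; first by split; exact: subspace0.
by move=> a u v [Au Bu] [Av Bv]; split; exact: subspaceZD.
Qed.

Lemma subspace_set_sum M N :
  subspace M -> subspace N -> subspace (set_sum M N).
Proof.
move=> hM hN; apply/subspaceP; split.
  by exists 0; [exact: subspace0|exists 0; [exact: subspace0|rewrite addr0]].
move=> a _ _ [m Mm [n Nn <-]] [m' Mm' [n' Nn' <-]].
exists (a *: m + m'); first exact: subspaceZD.
exists (a *: n + n'); first exact: subspaceZD.
by rewrite scalerDr addrACA.
Qed.

Section RelationClosure.
Context {T : set (X * X)} (hT : linear_relation T).

Lemma linear_relationZD a x y x' y' :
  T (x, y) -> T (x', y') -> T (a *: x + x', a *: y + y').
Proof. by move=> Txy Txy'; exact: (subspaceZD hT a Txy Txy'). Qed.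

Lemma linear_relationD x y x' y' :
  T (x, y) -> T (x', y') -> T (x + x', y + y').
Proof. by move=> Txy Txy'; exact: (subspaceD hT Txy Txy'). Qed.

Lemma linear_relationB x y x' y' :
  T (x, y) -> T (x', y') -> T (x - x', y - y').
Proof. by move=> Txy Txy'; exact: (subspaceB hT Txy Txy'). Qed.

Lemma subspace_rel_dom : subspace (rel_dom T).
Proof.
apply/subspaceP; split; first by exists 0; exact: (subspace0 hT).
move=> a x x' [y Txy] [y' Txy'].
by exists (a *: y + y'); exact: (linear_relationZD a Txy Txy').
Qed.

Lemma subspace_rel_ran : subspace (rel_ran T).
Proof.
apply/subspaceP; split; first by exists 0; exact: (subspace0 hT).
move=> a y y' [x Txy] [x' Txy'].
by exists (a *: x + x'); exact: (linear_relationZD a Txy Txy').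
Qed.

Lemma subspace_rel_ker : subspace (rel_ker T).
Proof.
apply/subspaceP; split; first exact: (subspace0 hT).
move=> a x x' Tx Tx'; have := linear_relationZD a Tx Tx'.
by rewrite /rel_ker /= scaler0 addr0.
Qed.

Lemma subspace_rel_mul : subspace (rel_mul T).
Proof.
apply/subspaceP; split; first exact: (subspace0 hT).
move=> a y y' Ty Ty'; have := linear_relationZD a Ty Ty'.
by rewrite /rel_mul /= scaler0 addr0.
Qed.

End RelationClosure.

(** Given a common pair [(x, z)], membership of [(x, y)] in either relation
    amounts to [y - z] lying in the shared multivalued part. *)
Lemma agreement_dom_setI T P :
  linear_relation T -> linear_relation P -> rel_mul T = rel_mul P ->
  agreement T P = rel_dom (T `&` P).
Proof.
move=> hT hP mulTP; have fibre Q x y z : linear_relation Q ->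
    Q (x, z) -> Q (x, y) <-> rel_mul Q (y - z).
  move=> hQ Qxz; split=> [Qxy|Qyz].
    by have := linear_relationB hQ Qxy Qxz; rewrite subrr.
  by have := linear_relationD hQ Qyz Qxz; rewrite add0r subrK.
rewrite eqEsubset; split=> x.
  move=> [[[z Txz] _] TPx]; exists z; split=> //.
  have : image_at T x z by rewrite /image_at /xsection /= inE.
  by rewrite TPx /image_at /xsection /= inE.
move=> [z [Txz Pxz]]; split; first by split; exists z.
rewrite eqEsubset; split=> y; rewrite /image_at /xsection /= !inE.
  by move=> /(fibre T x y z hT Txz); rewrite mulTP => /(fibre P x y z hP Pxz).
by move=> /(fibre P x y z hP Pxz); rewrite -mulTP => /(fibre T x y z hT Txz).
Qed.

(** * Multivalued projections *)

Lemma mvprojE M N x y :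
  subspace M -> subspace N -> mvproj M N (x, y) <-> M y /\ N (x - y).
Proof.
move=> hM hN; split=> [[m Mm [n Nn [<- <-]]]|[My Nxy]].
  by split=> //; rewrite addrC addKr.
by exists y => //; exists (x - y) => //; rewrite addrC subrK.
Qed.

Lemma linear_mvproj M N :
  subspace M -> subspace N -> linear_relation (mvproj M N).
Proof.
move=> hM hN; apply/subspaceP; split.
  by apply/mvprojE => //; rewrite subrr; split; exact: subspace0.
move=> a [x y] [x' y'] /(mvprojE x y hM hN)[My Nxy].
move=> /(mvprojE x' y' hM hN)[My' Nxy'].
apply/mvprojE => //; split; first exact: subspaceZD.
by rewrite opprD addrACA -scalerBr; exact: subspaceZD.
Qed.

Lemma multivalued_projection_mvproj M N :
  subspace M -> subspace N -> multivalued_projection (mvproj M N).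
Proof.
move=> hM hN.
have fix_range y : M y -> mvproj M N (y, y).
  by move=> My; apply/mvprojE => //; rewrite subrr; split=> //; exact: subspace0.
split; first exact: linear_mvproj.
- rewrite eqEsubset; split=> -[x z] /=.
    move=> [y /(mvprojE x y hM hN)[My Nxy] /(mvprojE y z hM hN)[Mz Nyz]].
    apply/mvprojE => //; split=> //.
    by rewrite -[x](subrK y) -addrA; exact: subspaceD.
  move=> Pxz; exists z => //; apply: fix_range.
  by have /(mvprojE x z hM hN)[] := Pxz.
- move=> y [x /(mvprojE x y hM hN)[My _]]; exists y; exact: fix_range.
Qed.

Lemma rel_mul_mvproj M N :
  subspace M -> subspace N -> rel_mul (mvproj M N) = N `&` M.
Proof.
move=> hM hN; rewrite eqEsubset; split=> y.
  move=> /(mvprojE 0 y hM hN)[My]; rewrite sub0r => /(subspaceN hN).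
  by rewrite opprK.
by move=> [Ny My]; apply/mvprojE => //; rewrite sub0r; split=> //; exact: subspaceN.
Qed.

(** The range lies in the domain, so [y] has some image [z]; idempotence makes
    [z] an image of [x] as well, hence [z - y] lies in the multivalued part and
    may be subtracted from the image of [y]. *)
Lemma multivalued_projection_fix_ran {P x y} :
  multivalued_projection P -> P (x, y) -> P (y, y).
Proof.
move=> [hP PP ranP] Pxy.
have [z Pyz] : rel_dom P y by apply: ranP; exists x.
have Pxz : P (x, z) by rewrite -PP; exists y.
have := linear_relationB hP Pyz (linear_relationB hP Pxz Pxy).
by rewrite subrr subr0 opprB addrC subrK.
Qed.

Lemma multivalued_projection_ker {P x y} :
  multivalued_projection P -> P (x, y) -> rel_ker P (x - y).
Proof.
move=> hP Pxy; have [lP _ _] := hP.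
have := linear_relationB lP Pxy (multivalued_projection_fix_ran hP Pxy).
by rewrite subrr.
Qed.

(** * Products of two multivalued projections *)

(** [ker P + mul Q] is designed for this identity: if [y] in [mul Q] is sent by
    [P] to [z], then [z] and [y] differ by an element of [ker P], because [P]
    also sends [z] to itself; the argument reverses for [z] in the range. *)
Lemma rel_mul_prod P Q :
  multivalued_projection P ->
  set_sum (rel_ker P) (rel_mul Q) `&` rel_ran (rel_prod P Q)
    = rel_mul (rel_prod P Q).
Proof.
move=> hP; have [lP _ _] := hP; rewrite eqEsubset; split=> z.
  move=> [[n Pn [y Qy <-]] [x [w _ Pwz]]]; exists y => //.
  have := linear_relationB lP (multivalued_projection_fix_ran hP Pwz) Pn.
  by rewrite subr0 addrC addKr addrC.
move=> [y Qy Pyz]; split; last by exists 0; exists y.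
exists (z - y); last by exists y => //; rewrite subrK.
rewrite -opprB; apply: subspaceN; first exact: subspace_rel_ker.
exact: multivalued_projection_ker hP Pyz.
Qed.

(** The intermediate vector [y] of a pair [(x, z)] of the product is fixed by
    [Q], so [T] relates it to [z] as well; and [y - z] lies in [ker P].  Thus
    [y] is the component of [x] in the agreement set. *)
Lemma prod_dom_agreement P Q :
  multivalued_projection P -> multivalued_projection Q ->
  linear_relation (rel_prod P Q) ->
  exists S, [/\ subspace S, S `&` rel_ran (rel_prod P Q) = rel_mul (rel_prod P Q)
    & rel_dom (rel_prod P Q)
      = set_sum (agreement (rel_prod P Q) (mvproj (rel_ran (rel_prod P Q)) S))
          (rel_ker (rel_prod P Q))].
Proof.
move=> hP hQ hT; have [lP _ _] := hP; have [lQ _ _] := hQ.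
set T := rel_prod P Q in hT *; set S := set_sum (rel_ker P) (rel_mul Q).
have hS : subspace S.
  by apply: subspace_set_sum; [exact: subspace_rel_ker|exact: subspace_rel_mul].
have mulT : S `&` rel_ran T = rel_mul T by exact: rel_mul_prod.
have hR := subspace_rel_ran hT.
exists S; split=> //; rewrite agreement_dom_setI //.
- rewrite eqEsubset; split=> x.
    move=> [z [y Qxy Pyz]].
    have Tyz : T (y, z) by exists y => //; exact: multivalued_projection_fix_ran hQ Qxy.
    (* The element of [mul Q] in the decomposition of [y - z] is zero. *)
    exists y.
      exists z; split=> //; apply/mvprojE => //; split; first by exists y.
      exists (y - z); first exact: multivalued_projection_ker hP Pyz.
      by exists 0; [exact: (subspace0 lQ)|rewrite addr0].
    exists (x - y); last by rewrite addrC subrK.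
    exists 0; [exact: multivalued_projection_ker hQ Qxy|exact: (subspace0 lP)].
  move=> [y [z [Tyz _]] [n Tn <-]].
  by exists (z + 0); exact: (linear_relationD hT Tyz Tn).
- exact: linear_mvproj.
- by rewrite rel_mul_mvproj.
Qed.

(** The decomposition of the domain provides, for each [x], a representative
    modulo [ker T] at which [T] coincides with [mvproj (rel_ran T) S]; choosing
    such a representative is what [mvproj A (rel_ker T)] does. *)
Lemma dom_agreement_prod T S :
  linear_relation T -> subspace S -> S `&` rel_ran T = rel_mul T ->
  rel_dom T = set_sum (agreement T (mvproj (rel_ran T) S)) (rel_ker T) ->
  exists P Q, [/\ multivalued_projection P, multivalued_projection Q
    & T = rel_prod P Q].
Proof.
move=> hT hS mulT domT; set P := mvproj (rel_ran T) S in domT *.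
have hR := subspace_rel_ran hT; have hker := subspace_rel_ker hT.
have lP : linear_relation P by exact: linear_mvproj.
have mulTP : rel_mul T = rel_mul P by rewrite rel_mul_mvproj.
rewrite agreement_dom_setI // in domT.
set A := rel_dom (T `&` P) in domT *.
have hA : subspace A by apply: subspace_rel_dom; exact: subspaceI.
(* At a point of [A] the graphs of [T] and [P] share a pair, so the two fibres
   there coincide. *)
have TP a z : A a -> T (a, z) <-> P (a, z).
  rewrite /A -agreement_dom_setI // => -[_ TPa].
  have : image_at T a z <-> image_at P a z by rewrite TPa.
  by rewrite /image_at /xsection /= !inE.
exists P, (mvproj A (rel_ker T)).
split; try exact: multivalued_projection_mvproj.
rewrite eqEsubset; split=> -[x z].
  move=> Txz; have : rel_dom T x by exists z.
  rewrite domT => -[a Aa [n Tn nE]]; exists a.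
    by exists a => //; exists n => //; rewrite nE.
  apply/TP => //=; have := linear_relationB hT Txz Tn.
  by rewrite -nE addrK subr0.
move=> [a /= [m Am [n Tn [<- <-]]] /(TP m z Am) Tmz].
by have := linear_relationD hT Tmz Tn; rewrite addr0.
Qed.

End LinearRelationTheory.

Theorem corollary6p3 (R : realType) (k : scalar_kind)
    (X : lmodType (scalars R k)) (T : set (X * X))
    (hT : linear_relation T) :
  (exists P Q : set (X * X),
      [/\ multivalued_projection P, multivalued_projection Q
        & T = rel_prod P Q])
  <->
  (exists S : set X,
      [/\ subspace S, S `&` rel_ran T = rel_mul T
        & rel_dom T = set_sum (agreement T (mvproj (rel_ran T) S)) (rel_ker T)]).
Proof.
split=> [[P [Q [hP hQ TE]]]|[S [hS mulT domT]]].
  by rewrite TE in hT *; exact: prod_dom_agreement.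
exact: dom_agreement_prod domT.
Qed.
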